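(* For $n\ge0$, the coefficient $c(\phi^{(10)};n)$ is odd if and only if $n=5k^2+2k$ for some integer $k$ (positive, negative or zero), and the coefficient $c(\psi^{(10)};n)$ is odd if and only if $n=5k^2+4k+1$ for some integer $k$ (positive, negative or zero).
   Context: $(a;q)_n=\prod_{k=0}^{n-1}(1-aq^k)$. For a formal power series $g(q)=\sum_{n\ge0}c(n)q^n$, $c(g;n):=c(n)$. The tenth order mock theta functions are $$\phi^{(10)}(q)=\sum_{n=0}^\infty\frac{q^{n(n+1)/2}}{(q;q^2)_{n+1}},\qquad \psi^{(10)}(q)=\sum_{n=1}^\infty\frac{q^{n(n+1)/2}}{(q;q^2)_n}.$$ *)

(* Defs.v *)
From mathcomp Require Import all_boot all_order all_algebra.
Set Implicit Arguments.
Unset Strict Implicit.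
Unset Printing Implicit Defensive.
Import Order.TTheory GRing.Theory Num.Theory.
Local Open Scope ring_scope.

Definition qpoch (R : comNzRingType) (a q : R) (n : nat) : R :=
  \prod_(k < n) (1 - a * q ^+ k).

(* A formal power series sum_n f(n) q^n over the integers is its sequence of
   coefficients, so that c(f; n) is [f n]. *)
Definition fps := nat -> int.

Definition fps_of_poly (p : {poly int}) : fps := fun n => p`_n.

Definition fps_mul (f g : fps) : fps :=
  fun n => \sum_(i < n.+1) f i * g (n - i)%N.

(* For f 0 = 1, the coefficients of g = 1 / f satisfy
   g n = [n = 0] - sum_(i < n) g i * f (n - i); fps_inv_seq f n lists the first
   n of them. See fps_mulV. *)
Fixpoint fps_inv_seq (f : fps) (n : nat) : seq int :=
  if n is m.+1 then
    let s := fps_inv_seq f m in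
    rcons s ((m == 0)%N%:Z - \sum_(i < m) s`_i * f (m - i)%N)
  else [::].

Definition fps_inv (f : fps) : fps := fun n => (fps_inv_seq f n.+1)`_n.

(* The sum of the F n over n >= n0, for families such that F n has no
   coefficient of index < n: only the terms n <= m contribute to index m.
   fps_sumP shows that this is the limit for coefficientwise stabilisation. *)
Definition fps_sum (n0 : nat) (F : nat -> fps) : fps :=
  fun m => \sum_(n0 <= n < m.+1) F n m.

Definition fps_sums_to (n0 : nat) (F : nat -> fps) (f : fps) : Prop :=
  forall m, exists N, forall M, (N <= M)%N -> \sum_(n0 <= n < M) F n m = f m.

Definition phi10_term (n : nat) : fps :=
  fps_mul (fps_of_poly 'X^((n * n.+1)./2))
          (fps_inv (fps_of_poly (qpoch 'X 'X^2 n.+1))).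

Definition psi10_term (n : nat) : fps :=
  fps_mul (fps_of_poly 'X^((n * n.+1)./2))
          (fps_inv (fps_of_poly (qpoch 'X 'X^2 n))).

Definition phi10 : fps := fps_sum 0 phi10_term.

Definition psi10 : fps := fps_sum 1 psi10_term.

Lemma size_fps_inv_seq f n : size (fps_inv_seq f n) = n.
Proof. by elim: n => //= n IH; rewrite size_rcons IH. Qed.

Lemma nth_fps_inv_seq f n i : (i < n)%N -> (fps_inv_seq f n)`_i = fps_inv f i.
Proof.
elim: n => // n IH; rewrite ltnS leq_eqVlt => /orP[/eqP-> //|lt_in].
by rewrite /= nth_rcons size_fps_inv_seq lt_in IH.
Qed.

Lemma fps_invE f n :
  fps_inv f n = (n == 0)%N%:Z - \sum_(i < n) fps_inv f i * f (n - i)%N.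
Proof.
rewrite {1}/fps_inv /= nth_rcons size_fps_inv_seq ltnn eqxx.
by congr (_ - _); apply: eq_bigr => i _; rewrite nth_fps_inv_seq.
Qed.

Lemma fps_mulV f n : f 0%N = 1 -> fps_mul (fps_inv f) f n = (n == 0)%N%:Z.
Proof.
move=> f0; rewrite /fps_mul big_ord_recr /= subnn f0 mulr1 fps_invE.
by rewrite addrC subrK.
Qed.

Lemma qpochX_coef0 n : fps_of_poly (qpoch 'X 'X^2 n) 0 = 1.
Proof.
rewrite /fps_of_poly -horner_coef0 /qpoch horner_prod big1 // => k _.
by rewrite hornerD hornerN hornerM hornerX mul0r subr0 hornerC.
Qed.

Lemma fps_sumP n0 F :
    (forall n m, (m < n)%N -> F n m = 0) ->
  fps_sums_to n0 F (fps_sum n0 F).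
Proof.
move=> F0 m; exists (maxn n0 m.+1) => M; rewrite geq_max => /andP[le0 lem].
rewrite /fps_sum; case: (leqP n0 m.+1) => h.
  rewrite (big_cat_nat h lem) /= [X in _ + X](_ : _ = 0) ?addr0 //.
  by rewrite big_nat_cond big1 // => i /andP[/andP[hi _] _]; rewrite F0.
rewrite [RHS]big_geq ?(ltnW h) // big_nat_cond big1 // => i /andP[/andP[hi _] _].
by rewrite F0 // (leq_trans _ hi) // ltnW.
Qed.

Lemma fps_mulXn_lt k f m : (m < k)%N -> fps_mul (fps_of_poly 'X^k) f m = 0.
Proof.
move=> lt_mk; rewrite /fps_mul big1 // => i _.
by rewrite /fps_of_poly coefXn ltn_eqF ?mul0r // (leq_ltn_trans _ lt_mk) -1?ltnS.
Qed.

Lemma leq_triangle n : (n <= (n * n.+1)./2)%N.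
Proof.
case: n => // n; rewrite -{1}[n.+1]doubleK half_leq // -muln2.
by rewrite leq_mul2l.
Qed.

Lemma phi10P : fps_sums_to 0 phi10_term phi10.
Proof.
apply: fps_sumP => n m lt_mn.
exact/fps_mulXn_lt/(leq_trans lt_mn)/leq_triangle.
Qed.

Lemma psi10P : fps_sums_to 1 psi10_term psi10.
Proof.
apply: fps_sumP => n m lt_mn.
exact/fps_mulXn_lt/(leq_trans lt_mn)/leq_triangle.
Qed.

(* Main.v *)
Require Import Defs.
From mathcomp Require Import all_boot all_order all_algebra.
From mathcomp Require Import qpoly zify ring.
Import GRing.Theory.
Local Open Scope ring_scope.
Set Implicit Arguments.
Unset Strict Implicit.
Unset Printing Implicit Defensive.

(** Modulo 2 the signs of a series do not matter, and the two mock theta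
functions become congruent to series with alternating signs that are explicit
false theta functions of Rogers:

  sum_n (-1)^n q^(n(n+1)/2) / (q;q^2)_(n+1)
    = sum_(r>=0) (-1)^r (q^(5r^2+2r) + q^(5r^2+8r+3)),
  sum_n (-1)^n q^(n(n+3)/2) / (q;q^2)_(n+1)
    = sum_(r>=0) (-1)^r (q^(5r^2+4r) + q^(5r^2+6r+1)).

The exponents on the right are the values of 5k^2+2k and 5k^2+4k at k = r and
k = -(r+1). They are pairwise distinct, so modulo 2 the right-hand sides are
indicator series of these values; the second series is psi divided by q.

Both identities come from the Bailey lemma, here unfolded into two summations.
The Bailey pair (sum_pent_term) is the finite expansion

  1 / ((q)_n (q;q^2)_(n+1))
    = sum_r (-1)^r q^(3r^2+r) (1 - q^(4r+2)) / ((q)_(n-2r) (q)_(n+2r+2)),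

proved by induction on n with a telescoping certificate. Multiplying by
(-1)^n q^(n(n+1)/2) (q)_n or (-1)^n q^(n(n+3)/2) (q)_n and exchanging the two
sums leaves, for each r, inner sums over n that the 1phi1 summation evaluates
in closed form (sum_onephi_term):

  sum_m (-1)^m q^(m(m+1)/2 + ms) (q)_(m+d) / ((q)_m (q)_(m+d+s+1))
    = (q)_d / (q)_s,

with s = d for the first identity, where d is 2r or 2r+1, and with s = d + 1
for the second, where d = 2r.

All these identities are stated in a commutative ring where q is nilpotent:
there every 1 - q^k with k > 0 is a unit and infinite sums are finite sums. To
read off the coefficient of index n they are applied to the class of X in
F_2[X] / (X^(n+1)), to which a series is sent by truncation. *)

Local Notation tri n := 'C(n.+1, 2).

Lemma triS n : tri n.+1 = (tri n + n.+1)%N.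
Proof. by rewrite binS bin1 addnC. Qed.

Lemma triD m n : tri (m + n) = (tri m + tri n + m * n)%N.
Proof.
by elim: m => [|m IH]; rewrite ?add0n ?addn0 // addSn !triS IH; lia.
Qed.

Lemma tri_double r : tri (2 * r) = (2 * r * r + r)%N.
Proof. by elim: r => // r IH; rewrite mulnS !triS IH; lia. Qed.

Lemma leq_tri n : (n <= tri n)%N.
Proof. by elim: n => // n IH; rewrite triS; lia. Qed.

(** * The q-series identities over a nilpotent base *)

Section NilpotentBase.

Variables (R : comUnitRingType) (q : R) (N : nat).
Hypothesis qN0 : q ^+ N = 0.

Lemma expr_ge_nil m : (N <= m)%N -> q ^+ m = 0.
Proof. by move/subnK<-; rewrite exprD qN0 mulr0. Qed.

Lemma tri_nil n : (N <= n)%N -> q ^+ tri n = 0.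
Proof. by move=> le_Nn; apply/expr_ge_nil/(leq_trans le_Nn)/leq_tri. Qed.

(** The inverse is the geometric series, which is finite. *)
Lemma unit_sub1M x : 1 - q * x \is a GRing.unit.
Proof.
suff /unitrPr[y y1] :
    (1 - q * x) * (\sum_(i < N) (q * x) ^+ i) \is a GRing.unit.
  by apply/unitrPr; exists ((\sum_(i < N) (q * x) ^+ i) * y); rewrite mulrA.
have := subrX1 (q * x) N; rewrite exprMn qN0 mul0r sub0r => e.
by rewrite -opprB mulNr -e opprK unitr1.
Qed.

Lemma unit_sub1X k : 1 - q ^+ k.+1 \is a GRing.unit.
Proof. by rewrite exprS unit_sub1M. Qed.

Lemma qpoch_unit p n : qpoch q p n \is a GRing.unit.
Proof.
by rewrite /qpoch; elim/big_ind: _ => [|x y ? ?|i _];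
  rewrite ?unitr1 ?unitrM ?unit_sub1M //; apply/andP.
Qed.

Local Notation qfact := (qpoch q q).

Definition qfactV n := (qfact n)^-1.

Lemma qfactS n : qfact n.+1 = qfact n * (1 - q ^+ n.+1).
Proof. by rewrite /qpoch big_ord_recr /= -exprS. Qed.

Lemma qfactVS n : qfactV n = (1 - q ^+ n.+1) * qfactV n.+1.
Proof.
rewrite /qfactV qfactS invrM ?qpoch_unit ?unit_sub1X //.
by rewrite mulrA divrr ?mul1r // unit_sub1X.
Qed.

Lemma mul_qfactV n : qfact n * qfactV n = 1.
Proof. by rewrite divrr ?qpoch_unit. Qed.

Definition onephi_term r s m :=
  (-1) ^+ m * q ^+ (tri m + m * s) * qfact (m + r) *
  qfactV m * qfactV (m + r + s).+1.

(** The 1phi1 summation with a = q^(r+1) and c = q^(r+s+2). The case r = 0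
telescopes; the step from r to r + 1 multiplies the sum by 1 - q^(r+1), since
the terms agree with this up to the difference of a sequence g which vanishes
at 0 and at M. *)
Lemma sum_onephi_term r s M : (N <= M)%N ->
  \sum_(0 <= m < M) onephi_term r s m = qfact r * qfactV s.
Proof.
move=> le_NM.
have tri0 m : q ^+ (tri M + m) = 0 by rewrite exprD tri_nil ?mul0r.
elim: r => [|r IH].
  pose u m := - ((-1) ^+ m * q ^+ (tri m + m * s) * qfactV (m + s)).
  rewrite (telescope_sumr_eq u) // => [|m _].
    rewrite /u tri0 mulr0 mul0r oppr0 sub0r opprK bin_small //.
    by rewrite /qpoch big_ord0 !expr0 !mul1r.
  rewrite /u /onephi_term triS !addn0 addSn mulSn.
  have -> : (tri m + m.+1 + (s + m * s) = (tri m + m * s) + (m + s).+1)%N.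
    by lia.
  rewrite exprS (exprD _ _ (m + s).+1) (qfactVS (m + s)).
  move: (mul_qfactV m).
  move: (qfact m) (qfactV m) (q ^+ (_ + s).+1) => f i Q fi1.
  set S := (-1) ^+ m; set P := q ^+ _; set J := qfactV _.
  have -> : S * P * f * i * J = S * P * (f * i) * J by ring.
  by rewrite fi1; ring.
pose g m := - q ^+ r.+1 * (1 - q ^+ m) * onephi_term r s m.
have step m : onephi_term r.+1 s m =
    (1 - q ^+ r.+1) * onephi_term r s m + (g m.+1 - g m).
  rewrite /g /onephi_term triS mulSn !addnS !addSn !qfactS.
  rewrite (qfactVS m) (qfactVS (m + r + s).+1).
  have -> : (tri m + m + (s + m * s) = (tri m + m * s) + (m + s))%N by lia.
  by rewrite !(exprS, exprD); ring.
rewrite (eq_bigr _ (fun m _ => step m)) big_split /= -mulr_sumr IH.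
by rewrite telescope_sumr // /g /onephi_term tri0 qfactS expr0; ring.
Qed.

(** These are the q-binomial coefficients of 2n+1 and 2n over n-d, divided by
(q)_(2n+1) and (q)_(2n). Without these numerators Pascal's rule splits into
the relations (1 - q^(n+d+1)) odd(n,d) = even(n,d),
(1 - q^(n-d)) odd(n,d) = even(n,d+1), and their analogues from even n+1 to
odd n. *)
Definition nbin_odd n d :=
  if (d <= n)%N then qfactV (n - d) * qfactV (n + d).+1 else 0.

Definition nbin_even n d :=
  if (d <= n)%N then qfactV (n - d) * qfactV (n + d) else 0.

(** The coefficients of the Bailey pair are the bilateral sequence
(-1)^r q^(3r^2+r) at the indices 2r, folded onto r >= 0 by pairing r with
-1-r. *)
Definition pent_term n r := (-1) ^+ r * q ^+ (3 * r * r + r) *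
  (nbin_odd n r.*2 - q ^+ (4 * r + 2) * nbin_odd n r.*2.+1).

(** The same expansion serves for both mock theta functions: relative to q in
the form that defines pent_term, and relative to q^2 in this form. *)
Lemma pent_termE n r : pent_term n r =
  (-1) ^+ r * q ^+ (3 * r * r + r) * (1 - q ^+ (4 * r + 2)) *
  nbin_even n.+1 r.*2.+1.
Proof.
rewrite /pent_term /nbin_odd /nbin_even ltnS.
have -> : (4 * r + 2 = (r.*2 + r.*2).+2)%N by lia.
case: ltnP => lt_rn.
  rewrite (ltnW lt_rn); have [k ->] : exists k, n = (r.*2 + k).+1.
    by exists (n - r.*2).-1; lia.
  have -> : ((r.*2 + k).+1 - r.*2 = k.+1)%N by lia.
  have -> : ((r.*2 + k).+1 - r.*2.+1 = k)%N by lia.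
  have -> : ((r.*2 + k).+2 - r.*2.+1 = k.+1)%N by lia.
  rewrite !addSn !addnS (qfactVS k) (qfactVS (r.*2 + k + r.*2).+2).
  by rewrite !(exprS, exprD); ring.
case: leqP => le_rn; last by ring.
have -> : n = r.*2 by lia.
rewrite subnn subSS subnn !addSn addnS (qfactVS (r.*2 + _).+1).
by ring.
Qed.

(** The bilateral sum over k of (-1)^k q^(3k^2+k) nbin_even(n,2|k|) is unchanged
under k -> -k, but this reflection moves the pair of terms k = r, -1-r to the
pair k = -r, r+1. The difference of the two pairs is
pent_tele n r - pent_tele n r.+1. *)
Definition pent_tele n r := (-1) ^+ r *
  (q ^+ (3 * r * r - r) - q ^+ (3 * r * r + r)) * nbin_even n r.*2.

Lemma pent_term_step n r :
  (1 - q ^+ n.+1) * (1 - q ^+ (n + n).+3) * pent_term n.+1 r =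
  pent_term n r + q ^+ n.+1 * (pent_tele n.+1 r - pent_tele n.+1 r.+1).
Proof.
rewrite (pent_termE n) /pent_term /pent_tele /nbin_odd /nbin_even.
(* All exponents are written in terms of e = 3r^2 - r and 2r, so that what
   remains is a polynomial identity. *)
have -> : (3 * r * r + r = (3 * r * r - r) + r.*2)%N by nia.
have -> : (3 * r.+1 * r.+1 - r.+1 =
           (3 * r * r - r) + r.*2 + r.*2 + r.*2 + 2)%N by nia.
have -> : (3 * r.+1 * r.+1 + r.+1 =
           (3 * r * r - r) + r.*2 + r.*2 + r.*2 + r.*2 + 4)%N by nia.
have -> : (4 * r + 2 = r.*2 + r.*2 + 2)%N by lia.
move: (3 * r * r - r)%N => e.
rewrite doubleS (exprS (-1)).
have [lt_nr|lt_rn|eq_rn] := ltngtP n.+1 r.*2.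
- have -> : (r.*2.+1 < n.+1)%N = false by lia.
  by ring.
- have [k ->] : exists k, n = (r.*2 + k)%N by exists (n - r.*2)%N; lia.
  have -> : ((r.*2 + k).+1 - r.*2 = k.+1)%N by lia.
  have -> : ((r.*2 + k).+1 - r.*2.+1 = k)%N by lia.
  have -> : ((r.*2 + k).+1 - r.*2.+2 = k.-1)%N by lia.
  case: k => [|k]; rewrite !(addn0, addSn, addnS).
    rewrite ltnn (qfactVS 0) (qfactVS (_ + _).+1) (qfactVS (_ + _).+2).
    by rewrite !(exprS, exprD); ring.
  have -> : (r.*2.+1 < (r.*2 + k).+2)%N by lia.
  rewrite (qfactVS k) (qfactVS k.+1).
  rewrite (qfactVS (_ + _).+2) (qfactVS (_ + _).+3).
  by rewrite !(exprS, exprD); ring.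
- rewrite eq_rn (ltnNge r.*2.+1) leqnSn subnn (qfactVS (r.*2 + r.*2)).
  have -> : ((n + n).+3 = (r.*2 + r.*2).+1)%N by lia.
  by rewrite /= !(exprS, exprD); ring.
Qed.

(** The Bailey pair. Both sides satisfy the same first-order recurrence in n:
on the left the certificate pent_tele vanishes at 0, where its two powers of q
agree, and beyond n. *)
Lemma sum_pent_term n M : (n < M.*2)%N ->
  \sum_(0 <= r < M) pent_term n r = qfactV n * (qpoch q (q ^+ 2) n.+1)^-1.
Proof.
elim: n => [|n IH] lt_nM.
  case: M lt_nM => // M _; rewrite big_nat_recl // big1 ?addr0 => [|r _].
    rewrite /pent_term /nbin_odd /= expr0 mulr0 !mul1r subr0 /qfactV.
    by rewrite /qpoch !big_ord_recl !big_ord0 !expr0.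
  by rewrite /pent_term /nbin_odd doubleS /= !mulr0 subr0 mulr0.
have uu : (1 - q ^+ n.+1) * (1 - q ^+ (n + n).+3) \is a GRing.unit.
  by rewrite unitrM !unit_sub1X.
apply: (mulrI uu).
rewrite mulr_sumr (eq_bigr _ (fun r _ => pent_term_step n r)).
rewrite big_split /= IH ?(ltnW lt_nM) // -mulr_sumr.
rewrite (telescope_sumr_eq (fun r => - pent_tele n.+1 r)) // => [|r _]; last first.
  by rewrite opprK addrC.
have -> : pent_tele n.+1 0 = 0 by rewrite /pent_tele subrr mulr0 mul0r.
have -> : pent_tele n.+1 M = 0.
  by rewrite /pent_tele /nbin_even leqNgt lt_nM mulr0.
rewrite oppr0 subrr mulr0 addr0 (qfactVS n).
rewrite [qpoch _ _ n.+2]/qpoch big_ord_recr /= -/(qpoch q (q ^+ 2) n.+1).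
rewrite -exprM -exprS; have -> : (2 * n.+1).+1 = (n + n).+3 by lia.
rewrite invrM ?qpoch_unit ?unit_sub1X //.
by rewrite -[LHS](mulrK (unit_sub1X (n + n).+2)); ring.
Qed.

Lemma sum_shift d (F : nat -> R) : (forall n, (n < d)%N -> F n = 0) ->
  (forall n, (N <= n)%N -> F n = 0) ->
  \sum_(0 <= n < N) F n = \sum_(0 <= m < N) F (m + d)%N.
Proof.
move=> F0 FN.
have hi : \sum_(N <= n < N + d) F n = 0.
  by rewrite big_nat_cond big1 // => n /andP[/andP[/FN]].
have lo : \sum_(0 <= n < d) F n = 0.
  by rewrite big_nat_cond big1 // => n /andP[/andP[_ /F0]].
have -> : \sum_(0 <= n < N) F n = \sum_(0 <= n < N + d) F n.
  by rewrite [RHS](@big_cat_nat _ _ _ N) ?leq_addr //= hi addr0.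
rewrite (@big_cat_nat _ _ _ d) ?leq_addl //=.
by rewrite lo add0r -{1}[d]add0n big_addn addnK.
Qed.

Lemma sum_nbin_odd d :
  \sum_(0 <= n < N) (-1) ^+ n * q ^+ tri n * qfact n * nbin_odd n d =
  (-1) ^+ d * q ^+ tri d.
Proof.
rewrite (@sum_shift d) => [|n lt_nd|n le_Nn]; first last.
- by rewrite tri_nil // mulr0 !mul0r.
- by rewrite /nbin_odd leqNgt lt_nd mulr0.
transitivity ((-1) ^+ d * q ^+ tri d * (qfact d * qfactV d)); last first.
  by rewrite mul_qfactV mulr1.
rewrite -(@sum_onephi_term d d N) // mulr_sumr.
apply: eq_bigr => m _; rewrite /nbin_odd leq_addl addnK /onephi_term triD.
by rewrite !exprD; ring.
Qed.

Lemma sum_nbin_even d :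
  \sum_(0 <= n < N)
     (-1) ^+ n * q ^+ (tri n + n) * qfact n * nbin_even n.+1 d.+1 =
  (-1) ^+ d * q ^+ (tri d + d) / (1 - q ^+ d.+1).
Proof.
rewrite (@sum_shift d) => [|n lt_nd|n le_Nn]; first last.
- by rewrite exprD tri_nil // mul0r mulr0 !mul0r.
- by rewrite /nbin_even ltnS leqNgt lt_nd mulr0.
apply: (canRL (mulrK (unit_sub1X d))).
transitivity ((-1) ^+ d * q ^+ (tri d + d) *
              ((1 - q ^+ d.+1) * (qfact d * qfactV d.+1))).
  rewrite -(@sum_onephi_term d d.+1 N) // mulrC !mulr_sumr.
  apply: eq_bigr => m _; rewrite /nbin_even ltnS leq_addl subSS addnK.
  rewrite /onephi_term triD mulnS !addSn !addnS.
  by rewrite !exprD; ring.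
by rewrite (mulrCA (1 - _)) -qfactVS mul_qfactV mulr1.
Qed.

Lemma sum_qpochV (c : nat -> R) :
  \sum_(0 <= n < N) c n * (qpoch q (q ^+ 2) n.+1)^-1 =
  \sum_(0 <= r < N) \sum_(0 <= n < N) c n * qfact n * pent_term n r.
Proof.
rewrite exchange_big_nat; apply: eq_big_nat => n /andP[_ lt_nN] /=.
rewrite -mulr_sumr sum_pent_term; last by lia.
by rewrite mulrA -(mulrA _ (qfact n)) mul_qfactV mulr1.
Qed.

Lemma false_theta_phi :
  \sum_(0 <= n < N) (-1) ^+ n * q ^+ tri n * (qpoch q (q ^+ 2) n.+1)^-1 =
  \sum_(0 <= r < N) (-1) ^+ r * (q ^+ (5 * r * r + 2 * r)
                                 + q ^+ (5 * r * r + 8 * r + 3)).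
Proof.
rewrite sum_qpochV; apply: eq_bigr => r _.
pose x := (-1) ^+ r * q ^+ (3 * r * r + r).
pose c n := (-1) ^+ n * q ^+ tri n * qfact n.
have split_term n : c n * pent_term n r = x * (c n * nbin_odd n r.*2)
    - x * q ^+ (4 * r + 2) * (c n * nbin_odd n r.*2.+1).
  by rewrite /x /pent_term; ring.
rewrite (eq_bigr _ (fun n _ => split_term n)) sumrB -!mulr_sumr.
rewrite !sum_nbin_odd exprS -mul2n exprM sqrrN !expr1n triS tri_double /x.
have -> : (5 * r * r + 2 * r = (3 * r * r + r) + (2 * r * r + r))%N by nia.
have -> : (5 * r * r + 8 * r + 3 =
   (3 * r * r + r) + (4 * r + 2) + (2 * r * r + r + (2 * r).+1))%N by nia.
by rewrite !exprD; ring.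
Qed.

Lemma false_theta_psi :
  \sum_(0 <= n < N) (-1) ^+ n * q ^+ (tri n + n) *
     (qpoch q (q ^+ 2) n.+1)^-1 =
  \sum_(0 <= r < N) (-1) ^+ r * (q ^+ (5 * r * r + 4 * r)
                                 + q ^+ (5 * r * r + 6 * r + 1)).
Proof.
rewrite sum_qpochV; apply: eq_bigr => r _.
pose c n := (-1) ^+ n * q ^+ (tri n + n) * qfact n.
have split_term n : c n * pent_term n r =
    (-1) ^+ r * q ^+ (3 * r * r + r) * (1 - q ^+ (4 * r + 2)) *
    (c n * nbin_even n.+1 r.*2.+1).
  by rewrite pent_termE; ring.
rewrite (eq_bigr _ (fun n _ => split_term n)) -!mulr_sumr sum_nbin_even.
rewrite mulrA; apply: (canLR (mulrK (unit_sub1X r.*2))).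
rewrite -mul2n exprM sqrrN !expr1n tri_double.
have -> : (5 * r * r + 4 * r = (3 * r * r + r) + (2 * r * r + r + 2 * r))%N.
  by nia.
have -> : (5 * r * r + 6 * r + 1 =
   (3 * r * r + r) + (2 * r * r + r + 2 * r) + (2 * r).+1)%N by nia.
have -> : (4 * r + 2 = (2 * r).+1 + (2 * r).+1)%N by lia.
by rewrite !exprD; ring.
Qed.

End NilpotentBase.

(** * Truncation of power series *)

Section Truncation.

Variables (A : comNzRingType) (n : nat).
Local Notation trunc := (in_qpoly ('X^(n.+1) : {poly A})).

Lemma trunc_Xn : trunc 'X^(n.+1) = 0.
Proof.
apply: val_inj.
by rewrite /= mk_monic_Xn Pdiv.RingMonic.rmodpp ?monicXn.
Qed.

Lemma eq_trunc (p p' : {poly A}) :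
  (forall i, (i < n.+1)%N -> p`_i = p'`_i) -> trunc p = trunc p'.
Proof.
move=> eq_pp'; apply/eqP; rewrite -subr_eq0 -rmorphB /=.
rewrite -(poly_take_drop n.+1 (p - p')) rmorphD rmorphM /= trunc_Xn.
rewrite mulr0 addr0.
have -> : take_poly n.+1 (p - p') = 0; last by rewrite rmorph0.
apply/polyP=> i; rewrite coef_take_poly coef0 coefB.
by case: ifP => // /eq_pp' ->; rewrite subrr.
Qed.

Lemma coef_trunc (p : {poly A}) i :
  (i < n.+1)%N -> (trunc p : {poly A})`_i = p`_i.
Proof.
move=> lt_in; rewrite -(@eq_trunc (take_poly n.+1 p)) => [|j lt_jn].
  rewrite in_qpoly_small ?coef_take_poly ?lt_in //.
  by rewrite mk_monic_Xn size_polyXn ltnS size_take_poly.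
by rewrite coef_take_poly lt_jn.
Qed.

Definition fps_trunc (f : fps) := trunc (\poly_(i < n.+1) (f i)%:~R).

Lemma coef_fps_trunc f : (fps_trunc f : {poly A})`_n = (f n)%:~R.
Proof. by rewrite coef_trunc // coef_poly ltnSn. Qed.

Lemma fps_truncM f g : fps_trunc (fps_mul f g) = fps_trunc f * fps_trunc g.
Proof.
rewrite /fps_trunc -rmorphM; apply: eq_trunc => i lt_in.
rewrite coef_poly lt_in coefM rmorph_sum; apply: eq_bigr => j _ /=.
by rewrite rmorphM !coef_poly !(leq_ltn_trans _ lt_in) ?leq_subr // -ltnS.
Qed.

Lemma fps_trunc_poly p : fps_trunc (fps_of_poly p) = trunc (map_poly intr p).
Proof. by apply: eq_trunc => i lt_in; rewrite coef_poly lt_in coef_map. Qed.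

Lemma fps_trunc_Xn k : fps_trunc (fps_of_poly 'X^k) = trunc 'X ^+ k.
Proof. by rewrite fps_trunc_poly rmorphXn /= map_polyX rmorphXn. Qed.

Lemma fps_trunc_sum n0 F : (forall k m, (m < k)%N -> F k m = 0) ->
  fps_trunc (fps_sum n0 F) = \sum_(n0 <= k < n.+1) fps_trunc (F k).
Proof.
move=> F0; rewrite /fps_trunc -rmorph_sum; apply: eq_trunc => i lt_in.
rewrite coef_poly lt_in coef_sum /fps_sum (big_nat_widen _ _ n.+1) //.
rewrite big_mkcond rmorph_sum; apply: eq_bigr => k _ /=.
by rewrite coef_poly lt_in; case: ltnP => // lt_ik; rewrite F0.
Qed.

End Truncation.

Section TruncationInverse.

Variables (A : fieldType) (n : nat).
Local Notation trunc := (in_qpoly ('X^(n.+1) : {poly A})).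
Local Notation fps_trunc := (@fps_trunc A n).

Lemma fps_truncV f :
  f 0%N = 1 -> fps_trunc (fps_inv f) = (fps_trunc f)^-1.
Proof.
move=> f0; have fV1 : fps_trunc (fps_inv f) * fps_trunc f = 1.
  rewrite -fps_truncM -(rmorph1 trunc); apply: eq_trunc => i lt_in.
  by rewrite coef_poly lt_in fps_mulV // coef1; case: (i).
rewrite -[LHS](mulrK (x := fps_trunc f)) ?fV1 ?mul1r //.
by apply/unitrPr; exists (fps_trunc (fps_inv f)); rewrite mulrC.
Qed.

Lemma fps_trunc_qpochV k :
  fps_trunc (fps_inv (fps_of_poly (qpoch 'X 'X^2 k))) =
  (qpoch (trunc 'X) (trunc 'X ^+ 2) k)^-1.
Proof.
rewrite fps_truncV ?qpochX_coef0 // fps_trunc_poly /qpoch !rmorph_prod /=.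
congr _^-1; apply: eq_bigr => i _.
by rewrite !(rmorphB, rmorphM, rmorphXn, rmorph1) /= map_polyX.
Qed.

End TruncationInverse.

(** * Coefficients of theta series *)

(** Because the exponents are pairwise distinct, at most one of the indicators
is nonzero; so their sum does not vanish in any nontrivial ring when n is an
exponent. *)
Lemma sum_two_indicators (A : nzRingType) (e e' : nat -> nat) n :
    (forall r, r <= e r)%N -> (forall r, r <= e' r)%N ->
    injective e -> injective e' -> (forall r s, e r <> e' s) ->
  \sum_(0 <= r < n.+1) ((n == e r)%:R + (n == e' r)%:R : A) != 0 <->
  exists r, n = e r \/ n = e' r.
Proof.
move=> le_e le_e' inj_e inj_e' dis; split=> [nz|[r nr]].
  have /existsP[r /orP nr] : [exists r : 'I_n.+1, (n == e r) || (n == e' r)].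
    apply: contraR nz; rewrite negb_exists => /forallP no.
    rewrite big_mkord big1 // => r _; move: (no r); rewrite negb_or.
    by case/andP=> /negPf-> /negPf->; rewrite addr0.
  by exists r; case: nr => /eqP; auto.
have lt_rn : (r < n.+1)%N by rewrite ltnS; case: nr => ->.
have only_r s : s <> r -> n <> e s /\ n <> e' s.
  by move=> ne_sr; case: nr => ->; split; [move/inj_e/esym | apply: dis
    | move/esym; apply: dis | move/inj_e'/esym].
rewrite big_mkord (bigD1 (Ordinal lt_rn)) //= big1 => [|s ne_sr].
  rewrite addr0; case: nr => n_r.
    have ne : n <> e' r by rewrite n_r; apply: dis.
    by rewrite (introT eqP n_r) (introF eqP ne) addr0 oner_neq0.
  have ne : n <> e r by rewrite n_r => /esym; apply: dis.
  by rewrite (introT eqP n_r) (introF eqP ne) add0r oner_neq0.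
have ne : s <> r :> nat by move=> e_sr; case/eqP: ne_sr; apply: val_inj.
have [n_e n_e'] := only_r _ ne.
by rewrite (introF eqP n_e) (introF eqP n_e') addr0.
Qed.

(** The integer k corresponds to r when k = r and when k = -(r+1). *)
Lemma exists_int_quadratic a b c n : (b <= a)%N ->
  (exists k : int, n%:Z = a%:Z * k ^+ 2 + b%:Z * k + c%:Z) <->
  exists r, n = (a * r * r + b * r + c)%N \/
            n = (a * r * r + (a + a - b) * r + (a - b + c))%N.
Proof.
move=> le_ba; split=> [[[r|r] nk]|[r [->|->]]].
- by exists r; left; nia.
- by exists r; right; rewrite NegzE in nk; nia.
- by exists r%:Z; nia.
- by exists (- r.+1%:Z); nia.
Qed.

(** For 0 < b < a the values of a k^2 + b k at k = 0, -1, 1, -2, 2 and so on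
increase strictly, hence are distinct. *)
Lemma sum_theta_coef (A : nzRingType) a b c n : (0 < b < a)%N ->
  \sum_(0 <= r < n.+1) ((n == a * r * r + b * r + c)%N%:R +
     (n == a * r * r + (a + a - b) * r + (a - b + c))%N%:R : A) != 0 <->
  exists k : int, n%:Z = a%:Z * k ^+ 2 + b%:Z * k + c%:Z.
Proof.
case/andP=> b0 lt_ba; rewrite exists_int_quadratic ?(ltnW lt_ba) //.
have [d [-> d0]] : exists d, a = (b + d)%N /\ (0 < d)%N.
  by exists (a - b)%N; lia.
have -> : (b + d + (b + d) - b = b + d + d)%N by lia.
rewrite addKn.
apply: sum_two_indicators => [r|r|r s e_rs|r s e_rs|r s].
- by nia.
- by nia.
- by case: (ltngtP r s) => // lt_rs; rewrite -(subnKC lt_rs) in e_rs; nia.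
- by case: (ltngtP r s) => // lt_rs; rewrite -(subnKC lt_rs) in e_rs; nia.
by case: (leqP r s) => le_rs; rewrite -(subnKC le_rs); nia.
Qed.

(** * The mock theta functions modulo 2 *)

Section ModTwo.

Variable n : nat.
Local Notation trunc := (in_qpoly ('X^(n.+1) : {poly 'F_2})).
Local Notation q := (trunc 'X).
Local Notation fps_trunc := (@fps_trunc 'F_2 n).

Lemma truncX_nil : q ^+ n.+1 = 0.
Proof. by rewrite -rmorphXn /= trunc_Xn. Qed.

Lemma dvd2_fps_trunc f :
  (2 %| f n)%Z = ((fps_trunc f : {poly 'F_2})`_n == 0).
Proof. by rewrite coef_fps_trunc (dvdz_pcharf (pchar_Fp _)). Qed.

Lemma trunc_sign k : (-1) ^+ k = 1 :> {poly %/ ('X^(n.+1) : {poly 'F_2})}.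
Proof. by rewrite oppr_pchar2 ?expr1n // pchar_qpoly pchar_Fp. Qed.

Lemma coef_trunc_theta (e e' : nat -> nat) :
  (\sum_(0 <= r < n.+1) (-1) ^+ r * (q ^+ e r + q ^+ e' r) : {poly 'F_2})`_n =
  \sum_(0 <= r < n.+1) ((n == e r)%:R + (n == e' r)%:R).
Proof.
under eq_bigr => r _ do rewrite trunc_sign mul1r -!rmorphXn -rmorphD /=.
rewrite -rmorph_sum /= coef_trunc // coef_sum.
by apply: eq_bigr => r _; rewrite coefD !coefXn.
Qed.

Lemma fps_trunc_phi10 : fps_trunc phi10 =
  \sum_(0 <= r < n.+1) (-1) ^+ r * (q ^+ (5 * r * r + 2 * r)
                                 + q ^+ (5 * r * r + 8 * r + 3)).
Proof.
rewrite -(false_theta_phi truncX_nil) fps_trunc_sum => [|k m lt_mk]; last first.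
  exact/fps_mulXn_lt/(leq_trans lt_mk)/leq_triangle.
apply: eq_bigr => k _; rewrite fps_truncM fps_trunc_Xn fps_trunc_qpochV.
by rewrite trunc_sign mul1r bin2 mulnC.
Qed.

Lemma fps_trunc_psi10 : fps_trunc psi10 =
  \sum_(0 <= r < n.+1) (-1) ^+ r * (q ^+ (5 * r * r + 4 * r + 1)
                                 + q ^+ (5 * r * r + 6 * r + 2)).
Proof.
transitivity (q * \sum_(0 <= r < n.+1) (-1) ^+ r *
    (q ^+ (5 * r * r + 4 * r) + q ^+ (5 * r * r + 6 * r + 1))); last first.
  rewrite mulr_sumr; apply: eq_bigr => r _.
  by rewrite !addnS !addn0 !exprS; ring.
rewrite -(false_theta_psi truncX_nil) fps_trunc_sum => [|k m lt_mk]; last first.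
  exact/fps_mulXn_lt/(leq_trans lt_mk)/leq_triangle.
(* Since psi starts at index 1, its truncation has one term less. *)
have last0 : (-1) ^+ n * q ^+ (tri n + n).+1 *
    (qpoch q (q ^+ 2) n.+1)^-1 = 0.
  by rewrite (expr_ge_nil truncX_nil) ?mulr0 ?mul0r // ltnS leq_addl.
rewrite [in RHS]big_nat_recr //= mulrDr mulrA mulrCA -exprS last0 addr0.
rewrite mulr_sumr big_add1 /=.
apply: eq_bigr => k _; rewrite fps_truncM fps_trunc_Xn fps_trunc_qpochV.
rewrite trunc_sign mul1r mulrA -exprS; congr (q ^+ _ / _).
by rewrite -addnS -triS bin2 mulnC.
Qed.

End ModTwo.

Theorem theorem9p1 (n : nat) :
  (~~ (2 %| phi10 n)%Z <-> exists k : int, n%:Z = 5 * k ^+ 2 + 2 * k) /\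
  (~~ (2 %| psi10 n)%Z <-> exists k : int, n%:Z = 5 * k ^+ 2 + 4 * k + 1).
Proof.
rewrite !dvd2_fps_trunc fps_trunc_phi10 fps_trunc_psi10 !coef_trunc_theta.
split; last exact: (@sum_theta_coef 'F_2 5 4 1 n isT).
have := @sum_theta_coef 'F_2 5 2 0 n isT.
under eq_bigr => r _ do rewrite addn0.
case=> odd_theta theta_odd; split=> [/odd_theta[k nk]|[k nk]].
  by exists k; rewrite -[RHS]addr0.
by apply: theta_odd; exists k; rewrite addr0.
Qed.
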